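(* Let $d\in\{2,3\}$, let $n\ge 2$, and let $e_1,\dots,e_n\in\mathbb{R}^d$ be vectors with $\sum_{j=1}^n|e_j|=2$. Let $\mathcal{P}=\mathcal{P}(e_1,\dots,e_n)$ be the edge set ensemble of these edges and let $\ell=\left|\sum_{j=1}^n e_j\right|$ be the length by which its members fail to close. Then for every $k\in\{1,\dots,n\}$, $$\mathrm{sChord}(k,\mathcal{P})=\frac{k(n-k)}{n(n-1)}\sum_{j=1}^n|e_j|^2+\frac{k(k-1)}{n(n-1)}\,\ell^2 .$$
   Context: A polygon with $n$ edges in $\mathbb{R}^d$ (possibly not closed, considered up to translation) is an ordered list of edge vectors $(e_1,\dots,e_n)$; all polygons have total length $2$. The edge set ensemble $\mathcal{P}(e_1,\dots,e_n)$ is the collection of polygons $(e_{\sigma(1)},\dots,e_{\sigma(n)})$, $\sigma\in S_n$, obtained by rearranging the edges. All of them fail to close by the same vector $\sum_j e_j$. For a polygon $P=(e_1,\dots,e_n)$, the squared length of the chord skipping the first $k$ edges is $\mathrm{Chord}(k,P)=\left|\sum_{j=1}^k e_j\right|^2$, and $\mathrm{sChord}(k,\mathcal{P})$ is its average over the ensemble: $$\mathrm{sChord}(k,\mathcal{P})=\frac1{n!}\sum_{\sigma\in S_n}\left|\sum_{j=1}^k e_{\sigma(j)}\right|^2 .$$ *)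

(* Defs.v *)
From HB Require Import structures.
From mathcomp Require Import all_boot all_order all_algebra all_fingroup.
From mathcomp Require Import reals.
Set Implicit Arguments.
Unset Strict Implicit.
Unset Printing Implicit Defensive.
Import Order.TTheory GRing.Theory Num.Theory.
Local Open Scope ring_scope.

(* Euclidean norm: the library's norm `|v| on row vectors is the sup norm. *)
Definition enorm (R : realType) (d : nat) (v : 'rV[R]_d) : R :=
  Num.sqrt (\sum_(i < d) v 0 i ^+ 2).

(* A possibly open polygon up to translation: its ordered list of edges. *)
Definition polygon (R : realType) (d n : nat) : Type := n.-tuple 'rV[R]_d.

Definition polygon_length (R : realType) (d n : nat) (P : polygon R d n) : R :=
  \sum_(j < n) enorm (tnth P j).

Definition failure_to_close (R : realType) (d n : nat) (P : polygon R d n) :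
    'rV[R]_d :=
  \sum_(j < n) tnth P j.

(* The ensemble is kept as a family indexed by permutations, so that averages
   over it count repeated polygons with multiplicity when some edges agree. *)
Definition edge_set_ensemble (R : realType) (d n : nat) (P : polygon R d n)
    (s : 'S_n) : polygon R d n :=
  [tuple tnth P (s j) | j < n].

(* Edges are numbered from 0, so the first k edges are those with j < k. *)
Definition chord (R : realType) (d n k : nat) (P : polygon R d n) : R :=
  enorm (\sum_(j < n | (j < k)%N) tnth P j) ^+ 2.

Definition sChord (R : realType) (d n k : nat) (E : 'S_n -> polygon R d n) : R :=
  (n`!%:R)^-1 * \sum_(s : 'S_n) chord k (E s).

(* Main.v *)
Require Import Defs.
From HB Require Import structures.
From mathcomp Require Import all_boot all_order all_algebra all_fingroup.
From mathcomp Require Import reals.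
From mathcomp Require Import ring.
Set Implicit Arguments.
Unset Strict Implicit.
Unset Printing Implicit Defensive.
Import Order.TTheory GRing.Theory Num.Theory.
Local Open Scope ring_scope.

(** The squared Euclidean norm splits over coordinates, so the edges may be
    taken to be scalars a_j.  By 2-transitivity of S_n, the sum over s of
    a_(s i) a_(s j) takes only two values: p if i = j, and q otherwise.  Hence
    the sum over s of (sum_(j in B) a_(s j))^2 is #|B| p + #|B| (#|B| - 1) q.
    The relation n p = n! sum_j a_j^2 and the case of the full set B determine
    p and q. *)

Lemma perm_2transitive (T : finType) (i j i' j' : T) :
  i != j -> i' != j' -> exists t : {perm T}, t i = i' /\ t j = j'.
Proof.
move=> ij ij'; pose x := tperm i i' j.
(* The first transposition sends i to i' and j to x; the second sends x to j'. It fixes i', since j'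
   differs from i' and, by injectivity, so does x. *)
exists (tperm i i' * tperm x j')%g; rewrite !permM tpermL tpermL; split=> //.
by rewrite tpermD // 1?eq_sym // /x -{1}(tpermL i i') (inj_eq perm_inj).
Qed.

Lemma card_perm_type (T : finType) : #|{perm T}| = #|T|`!.
Proof.
rewrite -[in RHS]cardsT -card_perm; apply: eq_card => s; rewrite !inE.
by apply/esym/subsetP => x _; rewrite inE.
Qed.

Section PermutedSums.
Variables (F : numFieldType) (T : finType) (a : T -> F).
Implicit Types (i j : T) (B : {set T}).

Let corr i j : F := \sum_(s : {perm T}) a (s i) * a (s j).

(** The sum runs over the whole group, so s may be replaced by [t * s], which applies t first. *)
Lemma corr_perm (t : {perm T}) i j : corr (t i) (t j) = corr i j.
Proof.
rewrite [RHS](reindex_inj (mulgI t)).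
by apply: eq_bigr => s _; rewrite !permM.
Qed.

Lemma corr_diag i j : corr i i = corr j j.
Proof. by rewrite -(corr_perm (tperm i j) i) tpermL. Qed.

Lemma corr_offdiag i j i' j' : i != j -> i' != j' -> corr i j = corr i' j'.
Proof.
move=> ij ij'; have [t [<- <-]] := perm_2transitive ij ij'.
by rewrite corr_perm.
Qed.

Lemma sum_perm_sqr_corr i0 i1 B : i0 != i1 ->
  \sum_(s : {perm T}) (\sum_(j in B) a (s j)) ^+ 2 =
  #|B|%:R * corr i0 i0 + #|B|%:R * (#|B|%:R - 1) * corr i0 i1.
Proof.
move=> i01; under eq_bigr => s _ do rewrite expr2 big_distrlr /=.
rewrite exchange_big /=.
(* Every row of the double sum has one diagonal term and [#|B| - 1] off-diagonal ones, so its value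
   does not depend on i. *)
have row i : i \in B -> \sum_(s : {perm T}) \sum_(j in B) a (s i) * a (s j) =
    corr i0 i0 + (#|B|%:R - 1) * corr i0 i1.
  move=> iB; rewrite exchange_big (bigD1 i) //= -[X in X + _]/(corr i i).
  rewrite (corr_diag i i0) (eq_bigr (fun=> corr i0 i1)); last first.
    by move=> j /andP[_ ji]; apply: corr_offdiag; rewrite // eq_sym.
  rewrite (eq_bigl (mem (B :\ i))) ?sumr_const; last first.
    by move=> j; rewrite !inE andbC.
  by rewrite (cardsD1 i B) iB natrD addrAC subrr add0r mulr_natl.
rewrite (eq_bigr _ row) sumr_const -mulr_natl; ring.
Qed.

(** For fixed s, the squares [a (s i) ^+ 2] are those of a in another order, so each s contributes
    the same amount. *)
Lemma sum_corr_diag : \sum_i corr i i = #|T|`!%:R * \sum_j a j ^+ 2.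
Proof.
rewrite exchange_big /= (eq_bigr (fun=> \sum_j a j ^+ 2)); last first.
  by move=> s _; rewrite [RHS](reindex_inj (@perm_inj _ s)).
by rewrite sumr_const card_perm_type mulr_natl.
Qed.

Lemma mean_perm_sqr_sum B : (1 < #|T|)%N ->
  #|T|`!%:R^-1 * \sum_(s : {perm T}) (\sum_(j in B) a (s j)) ^+ 2 =
  #|B|%:R * (#|T|%:R - #|B|%:R) / (#|T|%:R * (#|T|%:R - 1))
    * \sum_j a j ^+ 2
  + #|B|%:R * (#|B|%:R - 1) / (#|T|%:R * (#|T|%:R - 1)) * (\sum_j a j) ^+ 2.
Proof.
move=> T2; have /card_gt1P [i0 [i1 [_ _ i01]]] := T2.
have n0 : #|T|%:R != 0 :> F by rewrite pnatr_eq0 -lt0n ltnW.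
have n1 : #|T|%:R - 1 != 0 :> F by rewrite subr_eq0 pnatr_eq1 gtn_eqF.
have f0 : #|T|`!%:R != 0 :> F by rewrite pnatr_eq0 -lt0n fact_gt0.
have pE : corr i0 i0 = #|T|`!%:R * (\sum_j a j ^+ 2) / #|T|%:R.
  rewrite -sum_corr_diag (eq_bigr (fun=> corr i0 i0)) => [|i _]; last first.
    exact: corr_diag.
  by rewrite sumr_const -(mulr_natl (corr _ _)) mulrC mulKf.
(* For the full set the inner sum is the same for every s, which leaves a linear equation for the
   off-diagonal value. *)
have qE : corr i0 i1 = (#|T|`!%:R * (\sum_j a j) ^+ 2 - #|T|%:R * corr i0 i0)
    / (#|T|%:R * (#|T|%:R - 1)).
  have := sum_perm_sqr_corr [set: T] i01; rewrite cardsT.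
  rewrite (eq_bigr (fun=> (\sum_j a j) ^+ 2)) => [|s _]; last first.
    rewrite [in RHS](reindex_inj (@perm_inj _ s)); congr (_ ^+ 2).
    by apply: eq_bigl => j; rewrite inE.
  rewrite sumr_const card_perm_type -(mulr_natl (_ ^+ 2)) => ->.
  by field; rewrite n0 n1.
rewrite (sum_perm_sqr_corr _ i01) qE pE.
by field; rewrite n0 n1 f0.
Qed.

End PermutedSums.

Lemma enorm_sqr (R : realType) (d : nat) (v : 'rV[R]_d) :
  enorm v ^+ 2 = \sum_(i < d) v 0 i ^+ 2.
Proof. by rewrite sqr_sqrtr // sumr_ge0 // => i _; apply: sqr_ge0. Qed.

Theorem proposition15 (R : realType) (d n : nat) (e : polygon R d n) (k : nat)
  (hd : d = 2%N \/ d = 3%N)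
  (hn : (2 <= n)%N)
  (hlen : polygon_length e = 2)
  (hk : (1 <= k <= n)%N) :
  sChord k (edge_set_ensemble e) =
    (k%:R * (n%:R - k%:R)) / (n%:R * (n%:R - 1))
      * (\sum_(j < n) enorm (tnth e j) ^+ 2)
    + (k%:R * (k%:R - 1)) / (n%:R * (n%:R - 1))
      * enorm (failure_to_close e) ^+ 2.
Proof.
have /andP[_ kn] := hk.
pose B := [set j : 'I_n | (j < k)%N].
(* Here [k <= n] matters: otherwise B would have only n elements. *)
have cB : #|B| = k.
  rewrite -sum1_card -[RHS]card_ord -sum1_card (big_ord_widen n (fun=> 1%N)) //.
  by apply: eq_bigl => j; rewrite inE.
have chordE s : chord k (edge_set_ensemble e s) =
    \sum_(i < d) (\sum_(j in B) tnth e (s j) 0 i) ^+ 2.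
  rewrite /chord enorm_sqr; apply: eq_bigr => i _; congr (_ ^+ 2).
  rewrite summxE; apply: eq_big => [j|j _]; first by rewrite inE.
  by rewrite tnth_mktuple.
rewrite /sChord (eq_bigr _ (fun s _ => chordE s)) exchange_big /= mulr_sumr.
(* The right side is linear in squared norms, so it splits over coordinates too, and the two sides
   can be compared one coordinate at a time. *)
under [in RHS]eq_bigr => j _ do rewrite enorm_sqr.
rewrite [in RHS]exchange_big /= enorm_sqr !mulr_sumr -big_split /=.
apply: eq_bigr => i _; rewrite summxE.
have := mean_perm_sqr_sum (fun j => tnth e j 0 i) B.
by rewrite card_ord cB; apply.
Qed.
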